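(* Let $n,N\ge 1$. If $f \colon \mathbb{C}^n \dashrightarrow \mathbb{C}^N$ is a rational map such that the restriction of $f$ to $\mathbb{B}_n$ is a proper map to $\mathbb{B}_N$, then $\lVert f(z)\rVert > 1$ for every $z \notin \overline{\mathbb{B}_n}$ that is not a pole of $f$.
   Context: $\mathbb{B}_n = \{z \in \mathbb{C}^n : \lVert z\rVert < 1\}$ is the open unit ball. A continuous map is proper if preimages of compact sets are compact. A rational map is $f=\frac{p}{q}$ with $p\colon\mathbb{C}^n\to\mathbb{C}^N$ and $q\colon\mathbb{C}^n\to\mathbb{C}$ polynomial, $q\not\equiv 0$, in lowest terms; its poles are the zeros of $q$. *)

(* Defs.v *)
From HB Require Import structures.
From mathcomp Require Import all_boot all_order all_algebra.
From mathcomp Require Import all_classical all_reals all_analysis.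
From mathcomp Require Import complex.
From mathcomp Require mpoly.
(* The notations of mpoly clash with those of MathComp-Analysis. *)
Import -(notations) mpoly.
Import Order.TTheory GRing.Theory Num.Theory numFieldNormedType.Exports.

Set Implicit Arguments.
Unset Strict Implicit.
Unset Printing Implicit Defensive.

Local Open Scope classical_set_scope.
Local Open Scope ring_scope.

(* R[i] has no topology in the libraries: give it the one of its modulus.
   Row vectors over R[i] then carry the product topology, which is the usual
   topology of C^n. *)
HB.instance Definition _ (R : realType) := NormedModule.copy R[i] R[i]^o.

(* The norm `|z| of a row vector in the libraries is the sup norm. *)
Definition enorm (R : realType) (n : nat) (z : 'rV[R[i]]_n) : R :=
  Num.sqrt (\sum_(i < n) Normc.normc (z ord0 i) ^+ 2).

Definition unit_ball (R : realType) (n : nat) : set 'rV[R[i]]_n :=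
  [set z | enorm z < 1].
Arguments unit_ball : clear implicits.

(* f restricts to a proper map from A to B, both with the subspace topology.
   Compactness of a subset is intrinsic, so it may be taken in T and U. *)
Definition restricts_to_proper (T U : topologicalType)
    (A : set T) (B : set U) (f : T -> U) : Prop :=
  [/\ f @` A `<=` B,
      {within A, continuous f} &
      forall K : set U, K `<=` B -> compact K -> compact (A `&` f @^-1` K)].

Definition mpdvd (n : nat) (A : comNzRingType) (d p : mpoly n A) : Prop :=
  exists e : mpoly n A, p = d * e.

(* Rational maps p/q from C^n to C^N, in lowest terms: the common divisors of
   q and of all the components of p are the units, i.e. the nonzero constants.
*)
Record ratmap (R : realType) (n N : nat) := RatMap {
  ratnum : 'I_N -> mpoly n R[i];
  ratden : mpoly n R[i];
  ratden_neq0 : ratden != 0;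
  rat_lowest_terms : forall d : mpoly n R[i],
    mpdvd d ratden -> (forall j, mpdvd d (ratnum j)) ->
    exists2 c : R[i], c != 0 & d = mpolyC n c
}.

Definition mpeval (R : realType) (n : nat) (p : mpoly n R[i])
    (z : 'rV[R[i]]_n) : R[i] := meval (fun i => z ord0 i) p.

Definition poles (R : realType) (n N : nat) (f : ratmap R n N) :
    set 'rV[R[i]]_n := [set z | mpeval (ratden f) z = 0].

(* Meaningful outside of the poles of f only (it is 0 at the poles). *)
Definition rateval (R : realType) (n N : nat) (f : ratmap R n N)
    (z : 'rV[R[i]]_n) : 'rV[R[i]]_N :=
  \row_(j < N) (mpeval (ratnum f j) z / mpeval (ratden f) z).

(* Main.v *)
(* Let [u] be the unit vector in the direction of [z] and [s = |z|]. Properness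
   forces [|p|^2 = |q|^2] on the unit sphere, in particular at [t u] for
   [|t| = 1]. Since [conj t = 1 / t] there, this is a Laurent polynomial identity
   in [t], which therefore holds for all [t <> 0] in the polarized form
   [<p (t u), p (u / conj t)> = q (t u) conj (q (u / conj t))]. At [t = s] it
   says that [<f z, f (u / s)> = 1], where [|f (u / s)| < 1]. *)
Require Import Defs.
From mathcomp Require Import all_boot all_order all_algebra.
From mathcomp Require Import all_classical all_reals all_analysis.
From mathcomp Require Import complex.
From mathcomp Require Import ring lra.
From mathcomp Require mpoly.
Import -(notations) mpoly.
Import Order.TTheory GRing.Theory Num.Theory numFieldNormedType.Exports.

Local Open Scope classical_set_scope.
Local Open Scope ring_scope.

Local Notation normc := Normc.normc.
Local Notation realc := (real_complex _).

(** * Continuity, and restriction of polynomials to complex lines *)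

Lemma normrc {R : realType} (x : R[i]) : `|x| = realc (normc x).
Proof. by []. Qed.

Lemma near_dist_lt {K : numFieldType} (V : pseudoMetricNormedZmodType K)
    (x : V) (e : K) : 0 < e -> \forall t \near x, `|x - t| < e.
Proof. by move=> e0; apply: cvgr_dist_lt e0; exact: cvg_id. Qed.

Lemma norm_realc {R : realType} (r : R) : `|realc r| = realc `|r|.
Proof. by rewrite normrc /= expr0n /= addr0 sqrtr_sqr. Qed.

Lemma realc_continuous {R : realType} :
  continuous (fun r : R => (realc r : R[i])).
Proof.
(* The tolerance is a positive element of [R[i]]; by [ltcE] its imaginary part vanishes, so its real
   part [a] serves as a real tolerance. *)
move=> r; apply/cvgrPdist_lt => -[a b]; rewrite ltcE => /andP[/eqP /= -> a0].
apply: filterS (near_dist_lt _ r _ a0) => t.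
by rewrite -rmorphB norm_realc ltcR.
Qed.

Lemma normc_continuous {R : realType} :
  continuous (@Normc.normc R : R[i] -> R).
Proof.
move=> x; apply/(cvgrPdist_lt (FF := nbhs_filter x)) => e e0.
have e0' : 0 < realc e by rewrite ltcR.
have := near_dist_lt R[i] x _ e0'; apply: filterS => t.
move=> /(le_lt_trans (ler_dist_dist x t)).
by rewrite (normrc x) (normrc t) -rmorphB norm_realc ltcR.
Qed.

Lemma cvg_horner {K : numFieldType} {T : Type} {F : set_system T}
    {FF : Filter F} (p : {poly K}) (f : T -> K) (a : K) :
  f x @[x --> F] --> a -> p.[f x] @[x --> F] --> p.[a].
Proof.
move=> fa; elim/poly_ind: p => [|p c IHp].
  have -> : (fun x => (0 : {poly K}).[f x]) = cst 0.
    by apply/funext => x; rewrite horner0.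
  by rewrite horner0; exact: cvg_cst.
have -> : (fun x => (p * 'X + c%:P).[f x])
    = ((fun x => p.[f x]) \* f) + cst c.
  by apply/funext => x; rewrite hornerMXaddC.
by rewrite hornerMXaddC; apply: cvgD (cvgM IHp fa) (cvg_cst _).
Qed.

Lemma cvg_row {T : Type} {F : set_system T} {FF : Filter F}
    {U : topologicalType} {n : nat} (f : T -> 'rV[U]_n) (v : 'rV[U]_n) :
  (forall j, f x ord0 j @[x --> F] --> v ord0 j) -> f x @[x --> F] --> v.
Proof.
move=> fv A [P vP PA].
have : \forall x \near F, forall j, P ord0 j (f x ord0 j).
  by apply: filter_forall => j; exact: fv (vP ord0 j).
by apply: filterS => x Px; apply: PA => i j; rewrite ord1.
Qed.

(** Substituting [u_i X] for the [i]-th variable gives [P]. This reduces the theorem to polynomials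
    in one variable, on the line through [z] and the origin. *)
Lemma mpeval_line {R : realType} {n : nat} (p : mpoly n R[i])
    (u : 'rV[R[i]]_n) :
  exists P : {poly R[i]}, forall t, mpeval p (t *: u) = P.[t].
Proof.
exists (mmap polyC (fun i => (u ord0 i)%:P * 'X) p) => t.
rewrite /mpeval /meval /mmap horner_sum; apply: eq_bigr => m _.
rewrite hornerM hornerC /mmap1 horner_prod; congr (_ * _).
by apply: eq_bigr => i _; rewrite horner_exp hornerM hornerC hornerX mxE mulrC.
Qed.

(** * The Euclidean norm, and approach to the sphere along radii *)

Lemma normc_ge0 {R : realType} (x : R[i]) : 0 <= normc x.
Proof. by rewrite -ler0c -normrc. Qed.

Lemma sqr_enorm {R : realType} {n : nat} (z : 'rV[R[i]]_n) :
  enorm z ^+ 2 = \sum_(i < n) normc (z ord0 i) ^+ 2.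
Proof. by rewrite sqr_sqrtr // sumr_ge0 // => i _; exact: sqr_ge0. Qed.

Lemma enorm_ge0 {R : realType} {n : nat} (z : 'rV[R[i]]_n) : 0 <= enorm z.
Proof. exact: sqrtr_ge0. Qed.

Lemma enormZ {R : realType} {n : nat} (t : R[i]) (z : 'rV[R[i]]_n) :
  enorm (t *: z) = normc t * enorm z.
Proof.
rewrite /enorm -[in RHS](ger0_norm (normc_ge0 t)) -sqrtr_sqr.
rewrite -sqrtrM ?sqr_ge0 // mulr_sumr; congr Num.sqrt.
by apply: eq_bigr => i _; rewrite mxE Normc.normcM exprMn.
Qed.

Lemma normc_realc {R : realType} (r : R) : 0 <= r -> normc (realc r) = r.
Proof. by move=> r0; rewrite /= expr0n /= addr0 sqrtr_sqr ger0_norm. Qed.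

Lemma radius_continuous {R : realType} {n : nat} (z : 'rV[R[i]]_n) :
  continuous (fun r : R => realc r *: z).
Proof.
move=> r; apply: cvg_row => j; rewrite mxE.
have -> : (fun x : R => (realc x *: z) ord0 j)
    = (fun x : R => realc x : R[i]) \* cst (z ord0 j).
  by apply/funext => x; rewrite mxE.
by apply: cvgM (cvg_cst _); exact: realc_continuous.
Qed.

Lemma near_unit_interval (R : realType) :
  \forall r \near (1 : R)^'-, 0 < r < 1.
Proof.
near=> r; apply/andP; split; near: r; [exact: nbhs_left_gt|exact: nbhs_left_lt].
Unshelve. all: by end_near. Qed.

Lemma closure_unit_ball {R : realType} {n : nat} (z : 'rV[R[i]]_n) :
  enorm z <= 1 -> closure (unit_ball R n) z.
Proof.
move=> z1; have := cvg_at_left_filter (@radius_continuous R n z 1).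
rewrite /= scale1r; apply: closed_cvg; first exact: closed_closure.
apply: filterS (near_unit_interval R) => r /andP[r0 r1].
apply: subset_closure; rewrite /unit_ball /= enormZ.
by rewrite normc_realc ?(ltW r0) // (le_lt_trans _ r1) // ler_piMr // ltW.
Qed.

(** * Polynomial identities on the unit circle *)

Lemma mulc_conjc {R : realType} (x : R[i]) :
  x * conjc x = realc (normc x ^+ 2).
Proof. by rewrite -sqr_normc normrc rmorphXn. Qed.

Lemma conjc_inv_unit {R : realType} (t : R[i]) : normc t = 1 -> t^-1 = conjc t.
Proof.
move=> t1; have := mulc_conjc t; rewrite t1 expr1n rmorph1 => tt.
have t0 : t != 0.
  by apply/eqP => t0; move/eqP: tt; rewrite t0 mul0r eq_sym oner_eq0.
by apply: (mulfI t0); rewrite tt divff.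
Qed.

(* The Cayley transforms of the natural numbers are infinitely many points of
   the unit circle. *)
Lemma poly_eq0_on_circle {R : realType} (p : {poly R[i]}) :
  (forall t, normc t = 1 -> p.[t] = 0) -> p = 0.
Proof.
move=> p0.
pose c (k : nat) : R[i] := Complex 1 k%:R / conjc (Complex 1 k%:R).
have d0 (k : nat) : Complex 1 k%:R != 0 :> R[i].
  by rewrite eq_complex /= oner_eq0.
have cd0 (k : nat) : conjc (Complex 1 k%:R) != 0 :> R[i] by rewrite conjc_eq0.
apply: (@roots_geq_poly_eq0 _ p [seq c k | k <- iota 0 (size p)]).
- apply/allP => _ /mapP[k _ ->]; apply/rootP/p0.
  by rewrite /c Normc.normcM Normc.normcV /= sqrrN divff //.
- rewrite map_inj_uniq ?iota_uniq // => k l /eqP.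
  (* Cross-multiplying, the imaginary parts of [(1 + ik)(1 - il) = (1 + il)(1 - ik)] give
     [k - l = l - k]. *)
  rewrite eqr_div // => /eqP [_ kl].
  by apply/eqP; rewrite -(eqr_nat R); apply/eqP; lra.
- by rewrite size_map size_iota.
Qed.

(** Reversing the coefficients, padded to length [d + 1], gives [q]. As [d] may exceed the degree,
    several polynomials can share one factor [t ^+ d]. *)
Lemma poly_reflect {K : fieldType} (p : {poly K}) (d : nat) :
  (size p <= d.+1)%N ->
  exists q : {poly K}, forall t, t != 0 -> q.[t] = t ^+ d * p.[t^-1].
Proof.
move=> pd; exists (\sum_(i < d.+1) p`_i *: 'X^(d - i)) => t t0.
rewrite (horner_coef_wide _ pd) mulr_sumr horner_sum; apply: eq_bigr => i _.
rewrite hornerZ hornerXn exprVn mulrCA; congr (_ * _).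
by rewrite expfB_cond // (negPf t0); exact: (ltn_ord i).
Qed.

(** On the unit circle [(conjc t)^-1 = t], so the conclusion is the hypothesis there. Multiplied by
    a power of [t], both sides become polynomials, and these agree everywhere once they agree on the
    circle. *)
Lemma circle_identity {R : realType} {N : nat} (P : 'I_N -> {poly R[i]})
    (Q : {poly R[i]}) :
  (forall t, normc t = 1 ->
    \sum_j normc (P j).[t] ^+ 2 = normc Q.[t] ^+ 2) ->
  forall t, t != 0 ->
    \sum_j (P j).[t] * conjc (P j).[(conjc t)^-1]
    = Q.[t] * conjc Q.[(conjc t)^-1].
Proof.
move=> PQ t t0.
pose d := (size Q + \sum_j size (P j))%N.
have refl (p : {poly R[i]}) : (size p <= d.+1)%N ->
    {q : {poly R[i]} | forall s, s != 0 ->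
       q.[s] = s ^+ d * conjc p.[(conjc s)^-1]}.
  move=> pd; apply: cid.
  (* Conjugating the coefficients of [p] turns [conjc p.[(conjc s)^-1]] into a polynomial in
     [s^-1]. *)
  have [|q qE] := @poly_reflect _ (map_poly conjc p) d.
    by rewrite size_map_poly.
  exists q => s s0; rewrite qE //.
  by rewrite -conjc_inv -{1}[s^-1]conjcK horner_map.
have Pd j : (size (P j) <= d.+1)%N.
  rewrite leqW // /d (leq_trans _ (leq_addl _ _)) //.
  by rewrite (bigD1 j) //= leq_addr.
have Qd : (size Q <= d.+1)%N by rewrite leqW // leq_addr.
pose A j := sval (refl _ (Pd j)); pose B := sval (refl _ Qd).
have AE j s : s != 0 -> (A j).[s] = s ^+ d * conjc (P j).[(conjc s)^-1].
  exact: (svalP (refl _ (Pd j))).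
have BE s : s != 0 -> B.[s] = s ^+ d * conjc Q.[(conjc s)^-1].
  exact: (svalP (refl _ Qd)).
pose G := \sum_j P j * A j - Q * B.
have GE s : s != 0 -> G.[s] = s ^+ d *
    (\sum_j (P j).[s] * conjc (P j).[(conjc s)^-1]
     - Q.[s] * conjc Q.[(conjc s)^-1]).
  move=> s0; rewrite /G hornerD hornerN hornerM horner_sum BE // mulrBr mulrCA.
  congr (_ - _); rewrite mulr_sumr; apply: eq_bigr => j _.
  by rewrite hornerM AE // mulrCA.
have G0 : G = 0.
  apply: poly_eq0_on_circle => s s1.
  have s0 : s != 0.
    by apply/eqP => s0; move/eqP: s1; rewrite s0 Normc.normc0 eq_sym oner_eq0.
  rewrite GE // -conjc_inv conjc_inv_unit // conjcK mulc_conjc -PQ //.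
  rewrite rmorph_sum /= (eq_bigr _ (fun j _ => mulc_conjc (P j).[s])).
  by rewrite subrr mulr0.
apply/eqP; rewrite -subr_eq0; apply/eqP.
have := GE t t0; rewrite G0 horner0 => /esym/eqP.
by rewrite mulf_eq0 expf_eq0 (negPf t0) andbF /= => /eqP.
Qed.

(** * Behaviour of a proper rational map at the unit sphere *)

(* If [f] stayed inside the open ball at the boundary point, then the image of
   the radius ending there would be a compact subset of the ball whose preimage
   is not compact. *)
Lemma proper_boundary {R : realType} {n N : nat} (f : ratmap R n N)
    (u : 'rV[R[i]]_n) :
  unit_ball R n `&` poles f = set0 ->
  restricts_to_proper (unit_ball R n) (unit_ball R N) (rateval f) ->
  enorm u = 1 -> ~ poles f u -> 1 <= enorm (rateval f u).
Proof.
move=> f_def [f_ball _ f_proper] u1 fu; rewrite leNgt; apply/negP => fu1.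
have ray r : 0 <= r < 1 -> unit_ball R n (realc r *: u).
  by case/andP=> r0 r1; rewrite /unit_ball /= enormZ u1 mulr1 normc_realc.
pose g (r : R) := rateval f (realc r *: u).
have no_pole r : 0 <= r <= 1 -> ~ poles f (realc r *: u).
  case/andP=> r0; rewrite le_eqVlt => /predU1P[->|r1]; first by rewrite scale1r.
  move=> fr; have : (unit_ball R n `&` poles f) (realc r *: u).
    by split=> //; apply: ray; rewrite r0.
  by rewrite f_def.
(* The endpoint [r = 1] is included because [u] is not a pole. *)
have g_cont : {within `[0, 1], continuous g}.
  apply: continuous_in_subspaceT => r; rewrite inE /= in_itv /= => r01.
  have [Q QE] := mpeval_line (ratden f) u.
  apply: cvg_row => j; have [P PE] := mpeval_line (ratnum f j) u.
  have cP : P.[realc x] @[x --> r] --> P.[realc r].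
    by apply: cvg_horner; exact: realc_continuous.
  have cQ : Q.[realc x]^-1 @[x --> r] --> Q.[realc r]^-1.
    apply: cvgV; first by apply/eqP; rewrite -QE; exact: no_pole.
    by apply: cvg_horner; exact: realc_continuous.
  have gE x : g x ord0 j = P.[realc x] * Q.[realc x]^-1.
    by rewrite mxE PE QE.
  have -> : (fun x => g x ord0 j) =
      (fun x => P.[realc x]) \* (fun x => Q.[realc x]^-1).
    by apply/funext => x; exact: gE.
  by rewrite gE; exact: cvgM cP cQ.
have K_ball : g @` `[0, 1] `<=` unit_ball R N.
  move=> _ [r + <-]; rewrite /= in_itv /= => /andP[r0].
  rewrite le_eqVlt => /predU1P[->|r1]; first by rewrite /g scale1r.
  by apply: f_ball; exists (realc r *: u) => //; apply: ray; rewrite r0.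
have K_compact : compact (g @` `[0, 1]).
  by apply: continuous_compact => //; exact: segment_compact.
set S := unit_ball R n `&` rateval f @^-1` (g @` `[0, 1]).
have S_closed : closed S.
  apply: compact_closed; last exact: f_proper.
  exact: (@norm_hausdorff _ 'rV[R[i]]_n).
(* [S] contains [realc r *: u] for [0 < r < 1], and being closed it would contain the limit [u],
   which is not in the open ball. *)
suff [] : S u by rewrite /unit_ball /= u1 ltxx.
have := cvg_at_left_filter (@radius_continuous R n u 1).
rewrite /= scale1r; apply: (closed_cvg S S_closed).
apply: filterS (near_unit_interval R) => r /andP[r0 r1].
split; first by apply: ray; rewrite (ltW r0).
by exists r => //; rewrite /= in_itv /= !ltW.
Qed.

Lemma sqr_enorm_rateval {R : realType} {n N : nat} (f : ratmap R n N)
    (z : 'rV[R[i]]_n) : ~ poles f z ->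
  \sum_j normc (mpeval (ratnum f j) z) ^+ 2
  = normc (mpeval (ratden f) z) ^+ 2 * enorm (rateval f z) ^+ 2.
Proof.
move=> /eqP fz; rewrite sqr_enorm mulr_sumr; apply: eq_bigr => j _.
by rewrite -exprMn -Normc.normcM mxE mulrCA divff // mulr1.
Qed.

(* At a boundary point where the denominator vanishes, the numerators vanish
   too, so that the identity holds on the whole sphere. *)
Lemma proper_sphere_identity {R : realType} {n N : nat} (f : ratmap R n N)
    (u : 'rV[R[i]]_n) :
  unit_ball R n `&` poles f = set0 ->
  restricts_to_proper (unit_ball R n) (unit_ball R N) (rateval f) ->
  enorm u = 1 ->
  \sum_j normc (mpeval (ratnum f j) u) ^+ 2
  = normc (mpeval (ratden f) u) ^+ 2.
Proof.
move=> f_def f_prop u1.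
(* Inside the ball this is [enorm (rateval f _) < 1] with denominators cleared. In this form it
   passes to the limit along the radius even if [u] is a pole. *)
have le_pq : \sum_j normc (mpeval (ratnum f j) u) ^+ 2
    <= normc (mpeval (ratden f) u) ^+ 2.
  have cont (p : mpoly n R[i]) :
      normc (mpeval p (realc r *: u)) ^+ 2 @[r --> (1 : R)^'-]
      --> normc (mpeval p u) ^+ 2.
    have [P PE] := mpeval_line p u; rewrite -[u in X in _ --> X]scale1r PE.
    have -> : (fun r => normc (mpeval p (realc r *: u)) ^+ 2)
        = (fun r => normc P.[realc r]) \* (fun r => normc P.[realc r]).
      by apply/funext => r; rewrite PE.
    have nP : normc P.[realc r] @[r --> (1 : R)^'-] --> normc P.[1].
      apply: cvg_at_left_filter.
      apply: (continuous_cvg _ (@normc_continuous R P.[1])).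
      by apply: cvg_horner; exact: realc_continuous.
    exact: (cvgM nP nP).
  have sum_cvg : \sum_j normc (mpeval (ratnum f j) (realc r *: u)) ^+ 2
      @[r --> (1 : R)^'-] --> \sum_j normc (mpeval (ratnum f j) u) ^+ 2.
    by apply: cvg_big => [|j _]; [exact: add_continuous|exact: cont].
  apply: (ler_cvg_to sum_cvg (cont (ratden f))).
  apply: filterS (near_unit_interval R) => r /andP[r0 r1].
  have ru : unit_ball R n (realc r *: u).
    by rewrite /unit_ball /= enormZ u1 mulr1 normc_realc // ltW.
  have fru : ~ poles f (realc r *: u).
    by move=> fr; have : set0 (realc r *: u) by rewrite -f_def.
  rewrite sqr_enorm_rateval // ler_piMr ?sqr_ge0 //.
  rewrite expr_le1 ?enorm_ge0 // ltW //.
  by case: f_prop => f_ball _ _; apply: f_ball; exists (realc r *: u).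
apply/eqP; rewrite eq_le le_pq /=.
(* For the reverse inequality, a zero of the denominator makes the left side [0]; elsewhere
   [proper_boundary] applies. *)
have [->|/eqP q0] := eqVneq (mpeval (ratden f) u) 0.
  by rewrite Normc.normc0 expr0n /= sumr_ge0 // => j _; exact: sqr_ge0.
rewrite sqr_enorm_rateval // ler_peMr ?sqr_ge0 // exprn_ege1 //.
exact: proper_boundary.
Qed.

(** * The Hermitian pairing and the conclusion *)

(** Instead of Cauchy-Schwarz, [xy <= (x^2 + y^2) / 2] in each coordinate suffices, since the two
    squared norms add up to less than [2]. *)
Lemma normc_dot_lt1 {R : realType} {N : nat} (a b : 'rV[R[i]]_N) :
  enorm a <= 1 -> enorm b < 1 ->
  normc (\sum_j a ord0 j * conjc (b ord0 j)) < 1.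
Proof.
move=> a1 b1; rewrite -ltcR -normrc rmorph1.
apply: le_lt_trans (ler_norm_sum _ _ _) _.
have -> : \sum_j `|a ord0 j * conjc (b ord0 j)|
    = realc (\sum_j normc (a ord0 j) * normc (b ord0 j)).
  rewrite rmorph_sum; apply: eq_bigr => j _.
  by rewrite normrM normcJ !normrc rmorphM.
rewrite ltcR.
apply: (@le_lt_trans _ _ ((enorm a ^+ 2 + enorm b ^+ 2) / 2)).
  rewrite !sqr_enorm -big_split /= mulr_suml; apply: ler_sum => j _.
  have := sqr_ge0 (normc (a ord0 j) - normc (b ord0 j)).
  by rewrite sqrrB; lra.
have a2 : enorm a ^+ 2 <= 1 by rewrite exprn_ile1 // enorm_ge0.
have b2 : enorm b ^+ 2 < 1 by rewrite exprn_ilt1 // enorm_ge0.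
by lra.
Qed.

Theorem lemma2p1 (R : realType) (n N : nat) (n_ge1 : (1 <= n)%N)
    (N_ge1 : (1 <= N)%N) (f : ratmap R n N)
    (f_defined : unit_ball R n `&` poles f = set0)
    (f_proper : restricts_to_proper (unit_ball R n) (unit_ball R N)
                  (rateval f)) :
  forall z : 'rV[R[i]]_n, ~ closure (unit_ball R n) z -> ~ poles f z ->
    1 < enorm (rateval f z).
Proof.
move=> z z_out fz; set s := enorm z.
have s1 : 1 < s.
  by rewrite ltNge; apply/negP => s1; apply: z_out; exact: closure_unit_ball.
have s0 : 0 < s := lt_trans ltr01 s1.
have sc0 : realc s != 0 by rewrite gt_eqF // ltcR.
(* [w] is [z / s^2], the reflection of [z] in the unit sphere; it lies in the ball, where [f] has no
   poles. *)
pose u := realc s^-1 *: z; pose w := realc s^-1 *: u.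
have u1 : enorm u = 1.
  by rewrite enormZ normc_realc ?invr_ge0 ?ltW // mulVf ?gt_eqF.
have zE : z = realc s *: u by rewrite scalerA -rmorphM divff ?gt_eqF // scale1r.
have w1 : unit_ball R n w.
  rewrite /unit_ball /= enormZ u1 mulr1 normc_realc ?invr_ge0 ?(ltW s0) //.
  by rewrite invf_lt1.
have fw : ~ poles f w.
  by move=> fw; have : set0 w by rewrite -f_defined.
pose P j := sval (cid (mpeval_line (ratnum f j) u)).
pose Q := sval (cid (mpeval_line (ratden f) u)).
have PE j t : mpeval (ratnum f j) (t *: u) = (P j).[t].
  exact: (svalP (cid (mpeval_line (ratnum f j) u))).
have QE t : mpeval (ratden f) (t *: u) = Q.[t].
  exact: (svalP (cid (mpeval_line (ratden f) u))).
(* As [s] is real, [(conjc s)^-1 = s^-1], so the identity pairs the values at [s u = z] with those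
   at [s^-1 u = w]. *)
have := @circle_identity R N P Q _ (realc s) sc0.
rewrite conjc_real -[(realc s)^-1]fmorphV -QE.
under eq_bigr do rewrite -!PE.
rewrite -QE -zE -/w => pq.
have dot : \sum_j rateval f z ord0 j * conjc (rateval f w ord0 j) = 1.
  have q0 : mpeval (ratden f) z * conjc (mpeval (ratden f) w) != 0.
    by rewrite mulf_neq0 ?conjc_eq0 //; apply/eqP.
  apply: (mulfI q0); rewrite mulr1 -[RHS]pq; last first.
    (* The premise of [circle_identity]: for [t] on the unit circle, [t *: u] is on the unit
       sphere. *)
    move=> t t1; under eq_bigr do rewrite -PE.
    by rewrite -QE; apply: proper_sphere_identity; rewrite // enormZ t1 u1 mulr1.
  rewrite mulr_sumr; apply: eq_bigr => j _; rewrite !mxE rmorphM /= conjc_inv.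
  by field; rewrite conjc_eq0; apply/andP; split; apply/eqP.
have fw1 : enorm (rateval f w) < 1.
  by case: f_proper => f_ball _ _; apply: f_ball; exists w.
(* If [enorm (rateval f z) <= 1], the pairing, which equals [1], would have modulus less than
   [1]. *)
rewrite ltNge; apply/negP => fz1.
by have := normc_dot_lt1 _ _ fz1 fw1; rewrite dot Normc.normc1 ltxx.
Qed.
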